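(* Let $\mathcal A$ be a Banach operator ideal and $1\le\lambda<\infty$. Let $X$ be a Banach space and $\tau$ a topology on $\mathcal L(X)$. Then the following statements are equivalent. (i) $X$ has the $\lambda$-BAP for $\mathcal A^{reg}$ and $\tau$. (ii) For every Banach space $Y$ and for each operator $T\in\mathcal A(X;Y^* )$, there exists a net $(S_\alpha)$ in $\mathcal F(X)$ such that $S_\alpha\to I_X$ in $\tau$ and $\limsup_\alpha\|TS_\alpha\|_{\mathcal A}\le\lambda\|T\|_{\mathcal A}$. (iii) For every Banach space $Y$ and for each operator $T\in\mathcal A(X;Y^{**})$, there exists a net $(S_\alpha)$ in $\mathcal F(X)$ such that $S_\alpha\to I_X$ in $\tau$ and $\limsup_\alpha\|TS_\alpha\|_{\mathcal A}\le\lambda\|T\|_{\mathcal A}$.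
   Context: All Banach spaces are over the same field, real or complex. $\mathcal L(X)$ denotes the bounded operators on $X$, $\mathcal F(X)$ those of finite rank. For a Banach operator ideal $(\mathcal A,\|\cdot\|_{\mathcal A})$, the regular hull $\mathcal A^{reg}$ is defined by: $T\in\mathcal A^{reg}(X;Y)$ iff $J_YT\in\mathcal A(X;Y^{**})$, with $\|T\|_{\mathcal A^{reg}}=\|J_YT\|_{\mathcal A}$, where $J_Y\colon Y\to Y^{**}$ is the canonical inclusion. For a Banach operator ideal $\mathcal B$ and a topology $\tau$ on $\mathcal L(X)$, $X$ has the $\lambda$-BAP for $\mathcal B$ and $\tau$ if for every Banach space $Y$ and each $T\in\mathcal B(X;Y)$ there is a net $(S_\alpha)$ in $\mathcal F(X)$ such that $S_\alpha\to I_X$ in $\tau$ and $\limsup_\alpha\|TS_\alpha\|_{\mathcal B}\le\lambda\|T\|_{\mathcal B}$. *)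

(* Defs.v *)
From HB Require Import structures.
From mathcomp Require Import all_boot all_order all_algebra.
From mathcomp Require Import complex.
From mathcomp Require Import all_classical all_reals all_analysis.

Set Implicit Arguments.
Unset Strict Implicit.
Unset Printing Implicit Defensive.

Import Order.TTheory GRing.Theory Num.Theory.
Import numFieldNormedType.Exports.

Local Open Scope classical_set_scope.
Local Open Scope ring_scope.

Variant scalar_kind := RealScalars | ComplexScalars.

Definition scalar_field (R : realType) (k : scalar_kind) : numFieldType :=
  match k with
  | RealScalars => R : numFieldType
  | ComplexScalars => (R[i])%C : numFieldType
  end.

(* Library norms take values in the scalar field.  [rpart] and [rinj] move
   between that field and [R]; they are mutually inverse on nonnegative
   scalars (see [rpartK]). *)
Definition rpart (R : realType) (k : scalar_kind) : scalar_field R k -> R :=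
  match k return scalar_field R k -> R with
  | RealScalars => fun x => x
  | ComplexScalars => fun x => complex.Re x
  end.

Definition rinj (R : realType) (k : scalar_kind) : R -> scalar_field R k :=
  match k return R -> scalar_field R k with
  | RealScalars => fun x => x
  | ComplexScalars => fun x => (x%:C)%C
  end.
Arguments rinj {R} k.

Section ScalarTheory.
Context {R : realType} {k : scalar_kind}.
Local Notation K := (scalar_field R k).

Lemma rpartK (x : K) : 0 <= x -> rinj k (rpart x) = x.
Proof.
by case: k x => //= x x0; apply: RRe_real; exact: ger0_real.
Qed.

Lemma rinjK (r : R) : rpart (rinj k r) = r.
Proof. by case: k. Qed.

Lemma ler_rinj (r s : R) : (rinj k r <= rinj k s) = (r <= s).
Proof. by case: k => //=; rewrite lecR. Qed.

Lemma ltr_rinj (r s : R) : (rinj k r < rinj k s) = (r < s).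
Proof. by case: k => //=; rewrite ltcR. Qed.

Lemma rinj0 : rinj k (0 : R) = 0.
Proof. by case: k. Qed.

Lemma rinj1 : rinj k (1 : R) = 1.
Proof. by case: k. Qed.

Lemma rinjD (r s : R) : rinj k (r + s) = rinj k r + rinj k s.
Proof. by case: k => //=; rewrite rmorphD. Qed.

Lemma rinjM (r s : R) : rinj k (r * s) = rinj k r * rinj k s.
Proof. by case: k => //=; rewrite rmorphM. Qed.

Lemma rpartD (x y : K) : rpart (x + y) = rpart x + rpart y.
Proof. by case: k x y => //= -[? ?] [? ?]. Qed.

Lemma ler_rpart (x y : K) : 0 <= x -> 0 <= y -> (rpart x <= rpart y) = (x <= y).
Proof. by move=> x0 y0; rewrite -ler_rinj !rpartK. Qed.

Lemma rpart_ge0 (x : K) : 0 <= x -> 0 <= rpart x.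
Proof. by move=> x0; rewrite -ler_rinj rinj0 rpartK. Qed.

Lemma rpartM (x y : K) : 0 <= x -> 0 <= y -> rpart (x * y) = rpart x * rpart y.
Proof.
by move=> x0 y0; rewrite -[LHS]rinjK -[RHS]rinjK rinjM !rpartK// mulr_ge0.
Qed.

End ScalarTheory.

Definition rnorm (R : realType) (k : scalar_kind)
    (V : normedModType (scalar_field R k)) (x : V) : R := rpart `|x|.

Section RnormTheory.
Context {R : realType} {k : scalar_kind} {V : normedModType (scalar_field R k)}.
Implicit Types x y : V.

Lemma rnormE x : rinj k (rnorm x) = `|x|.
Proof. by rewrite rpartK. Qed.

Lemma rnorm_ge0 x : 0 <= rnorm x.
Proof. exact: rpart_ge0. Qed.

Lemma rnorm0 : rnorm (0 : V) = 0.
Proof. by rewrite /rnorm normr0 -rinj0 rinjK. Qed.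

Lemma rnorm_eq0 x : rnorm x = 0 -> x = 0.
Proof. by move=> x0; apply/eqP; rewrite -normr_eq0 -rnormE x0 rinj0. Qed.

Lemma rnormD x y : rnorm (x + y) <= rnorm x + rnorm y.
Proof. by rewrite -(@ler_rinj _ k) rinjD !rnormE ler_normD. Qed.

Lemma rnormZ (a : scalar_field R k) x : rnorm (a *: x) = rpart `|a| * rnorm x.
Proof. by rewrite /rnorm normrZ rpartM. Qed.

End RnormTheory.

(* The scalar field as a Banach space over itself, under a name of its own:
   the library already has a complete structure on [R^o], and a second one,
   for [(scalar_field R k)^o], would not be found. *)
Definition scalar_line (R : realType) (k : scalar_kind) : Type :=
  (scalar_field R k)^o.

HB.instance Definition _ R k := NormedModule.copy (scalar_line R k)
  (scalar_field R k)^o.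

Lemma real_part_cauchy (R : realType) (f : {additive R[i] -> R})
    (F : set_system (R[i])^o) :
  (forall z : R[i], (`|f z|%:C)%C <= `|z|) ->
  ProperFilter F -> cauchy F -> cvg (f @ F).
Proof.
move=> fle FF /cauchy_ballP cF; apply: R_complete.
apply/cauchy_ballP => e e0; have e0' : 0 < (e%:C)%C by rewrite ltcR.
have := cF _ e0'; rewrite -!ball_normE /=; rewrite !near_simpl => H.
near_simpl; apply: filterS H => -[x y] /= xy.
by rewrite -ltcR -raddfB; apply: le_lt_trans xy; exact: fle.
Qed.

Lemma norm_le_ReIm (R : realType) (z : R[i]) :
  `|z| <= ((`|complex.Re z| + `|complex.Im z|)%:C)%C.
Proof.
rewrite [in leLHS](complexE z) (le_trans (ler_normD _ _))// normrM rmorphD.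
rewrite lerD//= ?normc_def/= ?expr0n ?addr0 ?sqrtr_sqr//.
by rewrite expr1n add0r sqrtr1 mul1r.
Qed.

Lemma complex_complete (R : realType) (F : set_system (R[i])^o) :
  ProperFilter F -> cauchy F -> cvg F.
Proof.
move=> FF cF.
have normIm (z : R[i]) : (`|complex.Im z|%:C)%C <= `|z|.
  have -> : complex.Im z = - complex.Re (z * 'i%C).
    by case: z => a b /=; rewrite mulr0 mulr1 sub0r opprK.
  rewrite normrN (le_trans (normc_ge_Re _))// normrM.
  rewrite [X in _ * X]normc_def /= expr0n expr1n add0r sqrtr1 mulr1 //.
have /cvg_ex[a Fa] := @real_part_cauchy R (@complex.Re R) F
  (@normc_ge_Re R) FF cF.
have /cvg_ex[b Fb] := @real_part_cauchy R (@complex.Im R) F normIm FF cF.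
apply/cvg_ex; exists (Complex a b : (R[i])^o).
apply/cvgrPdist_lt => e e0.
have e0R : 0 < complex.Re e by rewrite -ltcR RRe_real// gtr0_real.
have e2 : 0 < complex.Re e / 2 by rewrite divr_gt0.
near=> z.
apply: le_lt_trans (norm_le_ReIm _) _.
rewrite -[ltRHS]RRe_real ?gtr0_real// ltcR [ltRHS]splitr ltrD//.
- by rewrite raddfB/=; near: z; exact: (proj1 (cvgrPdist_lt _ _) Fa).
- by rewrite raddfB/=; near: z; exact: (proj1 (cvgrPdist_lt _ _) Fb).
Unshelve. all: by end_near. Qed.

Lemma scalar_line_complete R k (F : set_system (scalar_line R k)) :
  ProperFilter F -> cauchy F -> cvg F.
Proof.
case: k F => F; [exact: (@R_complete R) | exact: (@complex_complete R)].
Qed.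

HB.instance Definition _ R k :=
  Uniform_isComplete.Build (scalar_line R k) (@scalar_line_complete R k).

Section BoundedOperators.
Context {R : realType} {k : scalar_kind}.
Local Notation K := (scalar_field R k).

Section Space.
Variables X Y : normedModType K.

Definition is_bounded_linear (f : X -> Y) : Prop :=
  linear f /\ exists M : R, forall x, rnorm (f x) <= M * rnorm x.

Definition bounded_linear : {pred X -> Y} :=
  fun f => `[< is_bounded_linear f >].

Record bop : Type := Bop { bop_fun :> X -> Y ; _ : bop_fun \in bounded_linear }.

HB.instance Definition _ := [isSub for bop_fun].
HB.instance Definition _ := [Choice of bop by <:].

Lemma bopP (f : bop) : is_bounded_linear f.
Proof. by case: f => f fP; apply/asboolP. Qed.

Lemma bounded_linear_submod : submod_closed bounded_linear.
Proof.
split.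
  apply/asboolP; split=> [a x y|]; first by rewrite scaler0 addr0.
  by exists 0 => x; rewrite rnorm0 mul0r.
move=> a f g /asboolP[lf [Mf fM]] /asboolP[lg [Mg gM]].
apply/asboolP; split=> [b x y|].
  rewrite /= !fctE lf lg !scalerDr !scalerA (mulrC a b).
  by rewrite addrACA.
exists (rpart `|a| * Mf + Mg) => x.
rewrite (le_trans (rnormD _ _))// mulrDl lerD// rnormZ -mulrA.
by rewrite ler_wpM2l// rpart_ge0.
Qed.

HB.instance Definition _ :=
  GRing.isSubmodClosed.Build K (X -> Y) bounded_linear bounded_linear_submod.
HB.instance Definition _ := [SubChoice_isSubLmodule of bop by <:].

HB.instance Definition _ (f : bop) :=
  GRing.isLinear.Build K X Y *:%R (f : X -> Y) (bopP f).1.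

Lemma bop_ext (f g : bop) : f =1 g -> f = g.
Proof. by move=> fg; apply/val_inj/funext. Qed.

Definition opnorm (f : bop) : R :=
  sup [set rnorm (f x) | x in [set x | rnorm x <= 1]].

Let ballim (f : bop) := [set rnorm (f x) | x in [set x | rnorm x <= 1]].

Lemma ballim_has_sup (f : bop) : has_sup (ballim f).
Proof.
split; first by exists (rnorm (f 0)), 0 => //=; rewrite rnorm0.
have [_ [M fM]] := bopP f.
exists (Num.max M 0) => _ [x /= x1 <-].
rewrite (le_trans (fM x))// (@le_trans _ _ (Num.max M 0 * rnorm x))//.
  by rewrite ler_wpM2r ?rnorm_ge0// le_max lexx.
by rewrite ler_piMr// le_max lexx orbT.
Qed.

Lemma opnorm_ge0 (f : bop) : 0 <= opnorm f.
Proof.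
apply: sup_ubound; first exact: (ballim_has_sup f).2.
by exists 0; rewrite /= ?rnorm0// linear0 rnorm0.
Qed.

Lemma le_opnorm (f : bop) x : rnorm (f x) <= opnorm f * rnorm x.
Proof.
have [->|x0] := eqVneq x 0; first by rewrite linear0 !rnorm0 mulr0.
have nx0 : `|x| != 0 by rewrite normr_eq0.
have fy : rnorm (f (`|x|^-1 *: x)) <= opnorm f.
  apply: sup_ubound; first exact: (ballim_has_sup f).2.
  exists (`|x|^-1 *: x) => //=.
  by rewrite /rnorm normrZ normfV normr_id mulVf// -(rinj1 (k := k)) rinjK.
have {1}-> : x = `|x| *: (`|x|^-1 *: x) by rewrite scalerA divff// scale1r.
by rewrite linearZ rnormZ normr_id mulrC ler_wpM2r// rnorm_ge0.
Qed.

Lemma opnorm_le (f : bop) M : 0 <= M ->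
  (forall x, rnorm (f x) <= M * rnorm x) -> opnorm f <= M.
Proof.
move=> M0 fM; apply: ge_sup; first exact: (ballim_has_sup f).1.
by move=> _ [x /= x1 <-]; rewrite (le_trans (fM x))// ler_piMr.
Qed.

Lemma opnormD (f g : bop) :
  rinj k (opnorm (f + g)) <= rinj k (opnorm f) + rinj k (opnorm g).
Proof.
rewrite -rinjD ler_rinj opnorm_le ?addr_ge0 ?opnorm_ge0// => x.
by rewrite mulrDl (le_trans (rnormD _ _))// lerD// le_opnorm.
Qed.

Lemma opnormZ_le (a : K) (f : bop) : opnorm (a *: f) <= rpart `|a| * opnorm f.
Proof.
rewrite opnorm_le ?mulr_ge0 ?opnorm_ge0 ?rpart_ge0// => x.
by rewrite rnormZ -mulrA ler_wpM2l ?rpart_ge0// le_opnorm.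
Qed.

Lemma opnormZ (a : K) (f : bop) :
  rinj k (opnorm (a *: f)) = `|a| * rinj k (opnorm f).
Proof.
rewrite -[`|a|]rpartK// -rinjM; congr rinj; apply/eqP.
rewrite eq_le opnormZ_le/=.
have [->|a0] := eqVneq a 0.
  by rewrite normr0 -(rinj0 (k := k)) rinjK mul0r opnorm_ge0.
have aa : rpart `|a| * rpart `|a^-1| = 1.
  by rewrite -rpartM// -normrM divff// normr1 -(rinj1 (k := k)) rinjK.
have -> : opnorm f = opnorm (a^-1 *: (a *: f)).
  by rewrite scalerA mulVf// scale1r.
rewrite (le_trans (ler_wpM2l _ (opnormZ_le _ _))) ?rpart_ge0//.
by rewrite mulrA aa mul1r.
Qed.

Lemma opnorm_eq0 (f : bop) : rinj k (opnorm f) = 0 -> f = 0.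
Proof.
move=> /(congr1 (@rpart _ _)); rewrite rinjK -(rinj0 (k := k)) rinjK => f0.
apply: bop_ext => x; apply: rnorm_eq0; apply/eqP.
by rewrite eq_le rnorm_ge0 andbT (le_trans (le_opnorm _ _))// f0 mul0r.
Qed.

HB.instance Definition _ := @Lmodule_isNormed.Build K bop
  (fun f => rinj k (opnorm f)) opnormD opnormZ opnorm_eq0.

Lemma bop_rnormE (f : bop) : rnorm f = opnorm f.
Proof. exact: rinjK. Qed.

End Space.
Arguments le_opnorm {X Y}.

Lemma cvg_rnorm (V : normedModType K) T (F : set_system T) (f : T -> V) l :
  Filter F -> f @ F --> l ->
  forall e : R, 0 < e -> \forall t \near F, rnorm (l - f t) < e.
Proof.
move=> FF /cvgrPdist_lt fl e e0.
have /fl : 0 < rinj k e by rewrite -(rinj0 (k := k)) ltr_rinj.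
by apply: filterS => t; rewrite -rnormE ltr_rinj.
Qed.

Lemma bop_complete (X : normedModType K) (Y : completeNormedModType K)
    (F : set_system (bop X Y)) : ProperFilter F -> cauchy F -> cvg F.
Proof.
move=> FF cF.
have cFR (e : R) : 0 < e -> exists f0, \forall f \near F, opnorm (f0 - f) < e.
  move=> e0; have e0' : 0 < rinj k e by rewrite -(rinj0 (k := k)) ltr_rinj.
  have /cauchyP/(_ _ e0')[f0 Ff0] := cF.
  exists f0; apply: filterS Ff0 => f; rewrite -ball_normE/=.
  by rewrite -rnormE ltr_rinj bop_rnormE.
have cvX x : exists l : Y, (fun f : bop X Y => f x) @ F --> l.
  apply/cvg_ex; apply: cauchy_cvg; apply: cauchy_exP => e e0.
  have e0R : 0 < rpart e.
    by rewrite -(@ltr_rinj _ k) rinj0 rpartK// ltW.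
  have x0 : 0 < rnorm x + 1 by rewrite ltr_wpDl// rnorm_ge0.
  have [f0 Ff0] := cFR (rpart e / (rnorm x + 1)) (divr_gt0 e0R x0).
  exists (f0 x); near_simpl; apply: filterS Ff0 => f ff.
  rewrite -ball_normE/= -rnormE -(rpartK (ltW e0)) ltr_rinj.
  rewrite (le_lt_trans (le_opnorm (f0 - f) x))//.
  rewrite (@le_lt_trans _ _ (opnorm (f0 - f) * (rnorm x + 1)))//.
    by rewrite ler_wpM2l ?opnorm_ge0// lerDl.
  by rewrite -ltr_pdivlMr.
pose L x := projT1 (cid (cvX x)).
have LP x : (fun f : bop X Y => f x) @ F --> L x := projT2 (cid (cvX x)).
have Llin : linear L.
  move=> a x y; apply: (cvg_unique (@norm_hausdorff _ Y) (LP _)).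
  rewrite (_ : (fun f : bop X Y => f (a *: x + y)) = (fun f => a *: f x + f y)).
    by apply: cvgD (LP y); apply: cvgZr; exact: LP.
  by apply/funext => f; rewrite linearP.
have Ldist (e : R) (f0 : bop X Y) : (\forall f \near F, opnorm (f0 - f) < e) ->
    forall x, rnorm (f0 x - L x) <= e * rnorm x.
  move=> Ff0 x; apply/ler_addgt0Pr => d d0.
  have Hd := @cvg_rnorm Y _ F (fun f : bop X Y => f x) (L x) _ (LP x) d d0.
  near F => f; rewrite (_ : f0 x - L x = (f0 - f) x - (L x - f x)); last first.
    by rewrite /= opprB addrA subrK.
  rewrite (le_trans (rnormD _ _))// lerD//.
    rewrite (le_trans (le_opnorm _ _))// ler_wpM2r ?rnorm_ge0// ltW//.
    by near: f.
  rewrite /rnorm normrN -/(rnorm _) ltW//.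
  by near: f; exact: Hd.
have Lb : L \in @bounded_linear X Y.
  apply/asboolP; split=> //.
  have [f0 Ff0] := cFR 1 ltr01.
  exists (opnorm f0 + 1) => x.
  rewrite -(subKr (f0 x) (L x)) (le_trans (rnormD _ _))// mulrDl lerD//.
    exact: le_opnorm.
  by rewrite /rnorm normrN; exact: Ldist.
apply/cvg_ex; exists (Bop Lb); apply/cvgrPdist_le => e e0.
have e0R : 0 < rpart e / 2.
  by rewrite divr_gt0// -(@ltr_rinj _ k) rinj0 rpartK// ltW.
have [f0 Ff0] := cFR _ e0R.
near=> f; rewrite -rnormE -(rpartK (ltW e0)) ler_rinj bop_rnormE.
rewrite opnorm_le ?rpart_ge0 ?ltW// => x.
rewrite (_ : (Bop Lb - f) x = (f0 - f) x - (f0 x - L x)); last first.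
  by rewrite /= opprB [RHS]addrC addrA subrK.
rewrite (le_trans (rnormD _ _))// [X in X * _]splitr mulrDl lerD//.
  rewrite (le_trans (le_opnorm _ _))// ler_wpM2r ?rnorm_ge0// ltW//.
  by near: f.
by rewrite /rnorm normrN; exact: Ldist.
Unshelve. all: by end_near. Qed.

HB.instance Definition _ (X : normedModType K) (Y : completeNormedModType K) :=
  Uniform_isComplete.Build (bop X Y) (@bop_complete X Y).

Lemma bop_id_subproof (X : normedModType K) :
  (fun x : X => x) \in @bounded_linear X X.
Proof. by apply/asboolP; split=> //; exists 1 => x; rewrite mul1r. Qed.

Definition bop_id (X : normedModType K) : bop X X := Bop (bop_id_subproof X).

Lemma bop_comp_subproof (X Y Z : normedModType K) (g : bop Y Z) (f : bop X Y) :
  (fun x => g (f x)) \in @bounded_linear X Z.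
Proof.
apply/asboolP; split=> [a x y|]; first by rewrite !linearP.
exists (opnorm g * opnorm f) => x.
by rewrite (le_trans (le_opnorm _ _))// -mulrA ler_wpM2l ?opnorm_ge0 ?le_opnorm.
Qed.

Definition bop_comp (X Y Z : normedModType K) (g : bop Y Z) (f : bop X Y) :
  bop X Z := Bop (bop_comp_subproof g f).

(* The range of [f] is the linear span of finitely many of its elements. *)
Definition finite_rank (X Y : normedModType K) (f : bop X Y) : Prop :=
  exists (n : nat) (v : 'I_n -> X),
    forall x, exists c : 'I_n -> K, f x = \sum_(i < n) c i *: f (v i).

Definition dual (Y : completeNormedModType K) : completeNormedModType K :=
  bop Y (scalar_line R k).

Definition bidual (Y : completeNormedModType K) : completeNormedModType K :=
  dual (dual Y).

Section CanonicalInclusion.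
Variable Y : completeNormedModType K.

Lemma bidual_eval_subproof (y : Y) :
  (fun phi : dual Y => phi y) \in @bounded_linear (dual Y) (scalar_line R k).
Proof.
apply/asboolP; split=> //; exists (rnorm y) => phi.
by rewrite mulrC bop_rnormE; exact: (le_opnorm phi y).
Qed.

Definition bidual_eval (y : Y) : bidual Y := Bop (bidual_eval_subproof y).

Lemma canonical_inclusion_subproof :
  bidual_eval \in @bounded_linear Y (bidual Y).
Proof.
apply/asboolP; split=> [a x y|].
  by apply: bop_ext => phi; rewrite /= linearP.
exists 1 => y; rewrite mul1r bop_rnormE; apply: opnorm_le => [|phi].
  exact: rnorm_ge0.
by rewrite mulrC bop_rnormE; exact: (le_opnorm phi y).
Qed.

Definition canonical_inclusion : bop Y (bidual Y) :=
  Bop canonical_inclusion_subproof.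

End CanonicalInclusion.

End BoundedOperators.

Section OperatorIdeals.
Variables (R : realType) (k : scalar_kind).
Local Notation K := (scalar_field R k).

(* A class of operators with a norm on it; the values of [class_norm] outside
   the class are irrelevant. *)
Record operator_class := OperatorClass {
  in_class : forall X Y : completeNormedModType K, set (bop X Y);
  class_norm : forall X Y : completeNormedModType K, bop X Y -> R
}.

Record banach_operator_ideal (A : operator_class) : Prop :=
  BanachOperatorIdeal {
  ideal0 : forall X Y : completeNormedModType K, in_class A (0 : bop X Y);
  idealD : forall (X Y : completeNormedModType K) (S T : bop X Y),
    in_class A S -> in_class A T -> in_class A (S + T);
  idealZ : forall (X Y : completeNormedModType K) (a : K) (T : bop X Y),
    in_class A T -> in_class A (a *: T);
  ideal_norm_ge0 : forall (X Y : completeNormedModType K) (T : bop X Y),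
    in_class A T -> 0 <= class_norm A T;
  ideal_norm_eq0 : forall (X Y : completeNormedModType K) (T : bop X Y),
    in_class A T -> class_norm A T = 0 -> T = 0;
  ideal_normD : forall (X Y : completeNormedModType K) (S T : bop X Y),
    in_class A S -> in_class A T ->
    class_norm A (S + T) <= class_norm A S + class_norm A T;
  ideal_normZ : forall (X Y : completeNormedModType K) (a : K) (T : bop X Y),
    in_class A T ->
    class_norm A (a *: T) = rpart `|a| * class_norm A T;
  ideal_complete : forall (X Y : completeNormedModType K) (u : nat -> bop X Y),
    (forall n, in_class A (u n)) ->
    (forall e : R, 0 < e -> exists N, forall m n, (N <= m)%N -> (N <= n)%N ->
      class_norm A (u m - u n) < e) ->
    exists2 T : bop X Y, in_class A T &
      forall e : R, 0 < e -> exists N, forall n, (N <= n)%N ->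
        class_norm A (u n - T) < e;
  ideal_comp : forall (W X Y Z : completeNormedModType K)
    (P : bop W X) (T : bop X Y) (Q : bop Y Z),
    in_class A T -> in_class A (bop_comp Q (bop_comp T P));
  ideal_norm_comp : forall (W X Y Z : completeNormedModType K)
    (P : bop W X) (T : bop X Y) (Q : bop Y Z), in_class A T ->
    class_norm A (bop_comp Q (bop_comp T P)) <=
      opnorm Q * class_norm A T * opnorm P;
  ideal_id : in_class A (bop_id (scalar_line R k));
  ideal_norm_id : class_norm A (bop_id (scalar_line R k)) = 1
}.

Definition regular_hull (A : operator_class) : operator_class := {|
  in_class := fun X Y =>
    [set T | in_class A (bop_comp (canonical_inclusion Y) T)];
  class_norm := fun X Y T => class_norm A (bop_comp (canonical_inclusion Y) T)
|}.

End OperatorIdeals.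

Record directed_set := DirectedSet {
  directed_sort :> Type;
  precedes : directed_sort -> directed_sort -> Prop;
  precedes_refl : forall a, precedes a a;
  precedes_trans : forall a b c, precedes a b -> precedes b c -> precedes a c;
  precedes_directed : forall a b, exists c, precedes a c /\ precedes b c;
  directed_inhabited : inhabited directed_sort
}.

Definition net_limsup (R : realType) (D : directed_set) (u : D -> \bar R) :
    \bar R :=
  ereal_inf [set ereal_sup [set u b | b in [set b | precedes a b]] | a in setT].

Record is_topology (T : Type) (tau : set_system T) : Prop := IsTopology {
  topology_setT : tau setT;
  topology_setI : setI_closed tau;
  topology_bigcup : forall (I : Type) (f : I -> set T),
    (forall i, tau (f i)) -> tau (\bigcup_i f i)
}.

Definition net_cvg (T : Type) (tau : set_system T) (D : directed_set)
    (u : D -> T) (l : T) : Prop :=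
  forall U, tau U -> U l -> exists a, forall b, precedes a b -> U (u b).

Section BoundedApproximation.
Context {R : realType} {k : scalar_kind}.
Local Notation K := (scalar_field R k).
Variables (B : operator_class R k) (X : completeNormedModType K).
Variables (tau : set_system (bop X X)) (lambda : R).

Definition approximable (Y : completeNormedModType K) (T : bop X Y) : Prop :=
  exists (D : directed_set) (S : D -> bop X X),
    [/\ forall a, finite_rank (S a),
        net_cvg tau S (bop_id X) &
        (net_limsup (fun a => (class_norm B (bop_comp T (S a)))%:E)
           <= (lambda * class_norm B T)%:E)%E].

Definition BAP : Prop :=
  forall (Y : completeNormedModType K) (T : bop X Y),
    in_class B T -> approximable T.

End BoundedApproximation.

(* Main.v *)
Require Import Defs.
From mathcomp Require Import all_boot all_order all_algebra.
From mathcomp Require Import all_classical all_reals all_analysis.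

(** The three conditions are proved in a cycle.  Condition (iii) is the case of
    (ii) in which the dual space is a bidual.

    Given (iii), let T : X -> Y lie in the regular hull of A.  Membership and
    the regular norm of T S are those of J_Y T S in A, so a net that
    approximates J_Y T with respect to A approximates T with respect to the
    regular hull; this is (i).

    Given (i), let T : X -> Y^* lie in A.  A dual space is 1-complemented in its
    bidual: the adjoint of J_Y : Y -> Y^** is a contraction Y^*** -> Y^* that is
    a left inverse of the inclusion of Y^* ([dual_map_canonical_inclusionK]).
    Composition with contractions does not increase the ideal norm, so on
    operators into Y^* the regular norm coincides with the norm of A
    ([class_norm_canonical_inclusion]), and the net that (i) provides for T
    serves in (ii). *)

Local Open Scope classical_set_scope.
Local Open Scope ring_scope.

Import Order.TTheory GRing.Theory Num.Theory.

Section DualMap.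
Context {R : realType} {k : scalar_kind}.
Local Notation K := (scalar_field R k).
Implicit Types Y Z : completeNormedModType K.

Lemma bop_compA {V W X Y : normedModType K}
    (h : bop X Y) (g : bop W X) (f : bop V W) :
  bop_comp h (bop_comp g f) = bop_comp (bop_comp h g) f.
Proof. exact: bop_ext. Qed.

Lemma bop_compf1 {X Y : normedModType K} (f : bop X Y) :
  bop_comp f (bop_id X) = f.
Proof. exact: bop_ext. Qed.

Lemma bop_comp1f {X Y : normedModType K} (f : bop X Y) :
  bop_comp (bop_id Y) f = f.
Proof. exact: bop_ext. Qed.

Lemma opnorm_id_le1 (X : normedModType K) : opnorm (bop_id X) <= 1.
Proof. by apply: opnorm_le => // x; rewrite mul1r. Qed.

Lemma opnorm_canonical_inclusion Y : opnorm (canonical_inclusion Y) <= 1.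
Proof.
apply: opnorm_le => // y; rewrite mul1r bop_rnormE.
apply: opnorm_le => [|phi]; first exact: rnorm_ge0.
by rewrite mulrC bop_rnormE; exact: (le_opnorm phi y).
Qed.

Lemma opnorm_comp {X Y Z : normedModType K} (g : bop Y Z) (f : bop X Y) :
  opnorm (bop_comp g f) <= opnorm g * opnorm f.
Proof.
apply: opnorm_le => [|x]; first by rewrite mulr_ge0 ?opnorm_ge0.
rewrite (le_trans (le_opnorm g (f x)))// -mulrA.
by rewrite ler_wpM2l ?opnorm_ge0 ?le_opnorm.
Qed.

Lemma dual_map_subproof {Y Z} (f : bop Y Z) :
  (fun phi : dual Z => bop_comp phi f : dual Y) \in
    @bounded_linear R k (dual Z) (dual Y).
Proof.
apply/asboolP; split=> [a phi psi|]; first exact: bop_ext.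
exists (opnorm f) => phi; rewrite mulrC !bop_rnormE; exact: opnorm_comp.
Qed.

(** The adjoint of [f]. *)
Definition dual_map {Y Z} (f : bop Y Z) : bop (dual Z) (dual Y) :=
  Bop (dual_map_subproof f).

Lemma opnorm_dual_map {Y Z} (f : bop Y Z) : opnorm (dual_map f) <= opnorm f.
Proof.
apply: opnorm_le => [|phi]; first exact: opnorm_ge0.
by rewrite mulrC !bop_rnormE; exact: opnorm_comp.
Qed.

(** The adjoint of the inclusion of [Y] restricts an element of the third dual
    to the evaluations at points of [Y]; restricting evaluation at [phi] in this
    way gives [phi] back. *)
Lemma dual_map_canonical_inclusionK Y :
  bop_comp (dual_map (canonical_inclusion Y)) (canonical_inclusion (dual Y)) =
  bop_id (dual Y).
Proof. by apply: bop_ext => phi; exact: bop_ext. Qed.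

End DualMap.

Section IdealNorm.
Context {R : realType} {k : scalar_kind} {A : operator_class R k}.
Hypothesis hA : banach_operator_ideal A.
Local Notation K := (scalar_field R k).
Implicit Types X Y Z : completeNormedModType K.

Lemma in_class_compl {X Y Z} (Q : bop Y Z) {T : bop X Y} :
  in_class A T -> in_class A (bop_comp Q T).
Proof. by move=> /(ideal_comp hA (bop_id X) Q); rewrite bop_compf1. Qed.

Lemma in_class_compr {W X Y : completeNormedModType K} (P : bop W X)
    {T : bop X Y} :
  in_class A T -> in_class A (bop_comp T P).
Proof. by move=> /(ideal_comp hA P (bop_id Y)); rewrite bop_comp1f. Qed.

Lemma class_norm_contraction {X Y Z} {Q : bop Y Z} {T : bop X Y} :
  opnorm Q <= 1 -> in_class A T ->
  class_norm A (bop_comp Q T) <= class_norm A T.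
Proof.
move=> Q1 AT; have T0 := ideal_norm_ge0 hA AT.
have := ideal_norm_comp hA (bop_id X) Q AT; rewrite bop_compf1 => /le_trans.
apply; rewrite (@le_trans _ _ (opnorm Q * class_norm A T))//.
  by rewrite ler_piMr ?mulr_ge0 ?opnorm_ge0 ?opnorm_id_le1.
by rewrite ler_piMl.
Qed.

(** The inclusion of a dual space in its bidual and the left inverse of
    [dual_map_canonical_inclusionK] are both contractions, so composing with
    either one cannot increase the norm. *)
Lemma class_norm_canonical_inclusion {X Y} {T : bop X (dual Y)} :
  in_class A T ->
  class_norm A (bop_comp (canonical_inclusion (dual Y)) T) = class_norm A T.
Proof.
move=> AT; apply/eqP; rewrite eq_le; apply/andP; split.
  exact: class_norm_contraction (opnorm_canonical_inclusion _) AT.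
have {1}-> : T = bop_comp (dual_map (canonical_inclusion Y))
    (bop_comp (canonical_inclusion (dual Y)) T).
  by rewrite bop_compA dual_map_canonical_inclusionK bop_comp1f.
apply: class_norm_contraction; last exact: in_class_compl.
exact: le_trans (opnorm_dual_map _) (opnorm_canonical_inclusion _).
Qed.

End IdealNorm.

(** Approximability sees an operator and its class only through the norms of
    the operator and of its compositions with operators on [X]; it is in this
    form that it passes between [A] and its regular hull. *)
Lemma eq_approximable {R : realType} {k : scalar_kind} {B C : operator_class R k}
    {X Y Z : completeNormedModType (scalar_field R k)}
    {tau : set_system (bop X X)} {lambda : R} {T : bop X Y} {V : bop X Z} :
  (forall S : bop X X,
     class_norm B (bop_comp T S) = class_norm C (bop_comp V S)) ->
  class_norm B T = class_norm C V ->
  approximable B tau lambda T -> approximable C tau lambda V.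
Proof.
move=> eqTS eqT [D [S [finS cvgS leS]]]; exists D, S; split=> //.
rewrite -eqT; move: leS.
by under eq_fun do rewrite eqTS.
Qed.

Theorem proposition3p1 (R : realType) (k : scalar_kind)
    (A : operator_class R k) (hA : banach_operator_ideal A)
    (lambda : R) (hlambda : 1 <= lambda)
    (X : completeNormedModType (scalar_field R k))
    (tau : set_system (bop X X)) (htau : is_topology tau) :
  (BAP (regular_hull A) tau lambda <->
    (forall (Y : completeNormedModType (scalar_field R k)) (T : bop X (dual Y)),
       in_class A T -> approximable A tau lambda T)) /\
  ((forall (Y : completeNormedModType (scalar_field R k)) (T : bop X (dual Y)),
       in_class A T -> approximable A tau lambda T) <->
    (forall (Y : completeNormedModType (scalar_field R k)) (T : bop X (bidual Y)),
       in_class A T -> approximable A tau lambda T)).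
Proof.
set bap := BAP _ _ _; set apx_dual := forall Y (T : bop X (dual Y)), _.
set apx_bidual := forall Y (T : bop X (bidual Y)), _.
have bap_dual : bap -> apx_dual.
  move=> h Y T AT.
  have regT : in_class (regular_hull A) T by exact: (in_class_compl hA).
  apply: (eq_approximable _ _ (h _ _ regT)) => [S|] /=.
    by rewrite (class_norm_canonical_inclusion hA)//; exact: (in_class_compr hA).
  exact: (class_norm_canonical_inclusion hA).
have dual_bidual : apx_dual -> apx_bidual by move=> h Y; exact: (h (dual Y)).
have bidual_bap : apx_bidual -> bap.
  move=> h Y T regT.
  by apply: (eq_approximable _ _ (h _ _ regT)) => [S|] //=; rewrite bop_compA.
split; split=> //; first by move=> /dual_bidual/bidual_bap.
by move=> /bidual_bap/bap_dual.
Qed.
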